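(* Let $V,V'\in\mathrm{Mod}(\mathcal U_q(\hat{\mathfrak g}))$ be two $l$-highest weight modules. Then $i(V)\otimes_f i(V')$ is an $(l,u)$-highest weight module.
   Context: **Cartan data.** $C=(C_{i,j})_{1\le i,j\le n}$ is a symmetrizable generalized Cartan matrix ($C_{i,j}\in\mathbb Z$, $C_{i,i}=2$, $C_{i,j}\le 0$ for $i\neq j$, $C_{i,j}=0\Leftrightarrow C_{j,i}=0$), $I=\{1,\dots,n\}$, $D=\mathrm{diag}(r_1,\dots,r_n)$ with positive integers $r_i$ such that $B=DC$ is symmetric. $q\in\mathbb C^*$ is not a root of unity, with rational powers fixed compatibly ($q^{s+t}=q^sq^t$); $q_i=q^{r_i}$, $[l]_q=\frac{q^l-q^{-l}}{q-q^{-1}}$, and $\begin{bmatrix}s\\k\end{bmatrix}_{q_i}$ is the $q_i$-binomial coefficient. $(\mathfrak h,\{\alpha_i\},\{\alpha_i^\vee\})$ is a realization of $C$: $\mathfrak h$ is a $\mathbb Q$-vector space of dimension $2n-\mathrm{rank}(C)$, the $\alpha_i\in\mathfrak h^*$ and the $\alpha_i^\vee\in\mathfrak h$ are linearly independent families, $\alpha_j(\alpha_i^\vee)=C_{i,j}$. $P=\{\lambda\in\mathfrak h^*\mid\lambda(\alpha_i^\vee)\in\mathbb Z\ \forall i\}$, $Q^+=\sum_i\mathbb N\alpha_i$, $\mathcal S(\lambda)=\lambda-Q^+$. **Quantum affinization.** $\mathcal U_q(\hat{\mathfrak g})$ is the $\mathbb C$-algebra with generators $x_{i,r}^{\pm}$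 ($i\in I,r\in\mathbb Z$), $k_h$ ($h\in\mathfrak h$), $h_{i,m}$ ($i\in I,m\in\mathbb Z\setminus\{0\}$) and relations: $k_hk_{h'}=k_{h+h'}$, $k_0=1$; all $k_h,h_{i,m}$ commute pairwise; $k_hx_{j,r}^{\pm}k_{-h}=q^{\pm\alpha_j(h)}x_{j,r}^{\pm}$; $h_{i,m}x_{j,r}^{\pm}-x_{j,r}^{\pm}h_{i,m}=\pm\frac1m[mB_{i,j}]_q x_{j,m+r}^{\pm}$; $x_{i,r}^+x_{j,s}^--x_{j,s}^-x_{i,r}^+=\delta_{i,j}\frac{\phi^+_{i,r+s}-\phi^-_{i,r+s}}{q_i-q_i^{-1}}$; $(w-q^{\pm B_{i,j}}z)x_i^{\pm}(z)x_j^{\pm}(w)=(q^{\pm B_{i,j}}w-z)x_j^{\pm}(w)x_i^{\pm}(z)$; and the affine quantum Serre relations: for $i\ne j$, $s=1-C_{i,j}$, $\sum_{\pi\in\Sigma_s}\sum_{k=0}^s(-1)^k\begin{bmatrix}s\\k\end{bmatrix}_{q_i}x_i^{\pm}(w_{\pi(1)})\cdots x_i^{\pm}(w_{\pi(k)})x_j^{\pm}(z)x_i^{\pm}(w_{\pi(k+1)})\cdots x_i^{\pm}(w_{\pi(s)})=0$. Here $x_i^\pm(w)=\sum_r x_{i,r}^\pm w^r$ and $\sum_{m\ge0}\phi^{\pm}_{i,\pm m}z^{\pm m}=k_{\pm r_i\alpha_i^\vee}\exp(\pm(q-q^{-1})\sum_{m\ge1}h_{i,\pm m}z^{\pm m})$,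 $\phi^+_{i,m}=0$ for $m<0$, $\phi^-_{i,m}=0$ for $m>0$. Convention: if $C_{i,j}C_{j,i}\le3$ for all $i\ne j$, $\mathcal U_q(\hat{\mathfrak g})$ denotes this algebra; otherwise it denotes the algebra defined in the same way without the affine quantum Serre relations. $\mathcal U_q'(\hat{\mathfrak g})=\mathcal U_q(\hat{\mathfrak g})\otimes\mathbb C(u)$. **Modules.** $V_\omega=\{v\mid k_h v=q^{\omega(h)}v\ \forall h\in\mathfrak h\}$ for $\omega\in\mathfrak h^*$. $\mathrm{Mod}(\mathcal U_q(\hat{\mathfrak g}))$ is the category of $\mathcal U_q(\hat{\mathfrak g})$-modules $V=\bigoplus_\omega V_\omega$ with all $V_\omega$ finite dimensional, all weights in a finite union $\bigcup_j\mathcal S(\lambda_j)$, and such that for all $\omega,i$ there is $R\ge0$ with $V_{\omega\pm r\alpha_i}=\{0\}$ for $r\ge R$. An $l$-weight is a couple $(\lambda,\Psi)$, $\lambda\in P$, $\Psi=(\Psi^\pm_{i,\pm m})_{i\in I,m\ge0}$, $\Psi^\pm_{i,\pm m}\in\mathbb C$, $\Psi^\pm_{i,0}=q_i^{\pm\lambda(\alpha_i^\vee)}$. A $\mathcal U_q(\hat{\mathfrak g})$-module $V$ is of $l$-highest weight $(\lambda,\Psi)$ if there is $v\in V_\lambda$ with $V=\mathcal U_q(\hat{\mathfrak g}).v$, $x^+_{i,r}v=0$, $\phi^\pm_{i,\pm m}v=\Psi^\pm_{i,\pm m}v$ for all $i\in I,r\in\mathbb Z,m\ge0$. An $(l,u)$-weight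 is a couple $(\lambda,\Psi(u))$, $\lambda\in\mathfrak h^*$, $\Psi(u)=(\Psi^\pm_{i,\pm m}(u))_{i\in I,m\ge0}$, $\Psi^\pm_{i,\pm m}(u)\in\mathbb C[u^{\pm1}]$, $\Psi^\pm_{i,0}(u)=q_i^{\pm\lambda(\alpha_i^\vee)}$. A $\mathcal U'_q(\hat{\mathfrak g})$-module $V$ is an $(l,u)$-highest weight module if there are an $(l,u)$-weight $(\lambda,\Psi(u))$ and $v\in V_\lambda$ with $V=\mathcal U'_q(\hat{\mathfrak g}).v$, $x^+_{i,r}v=0$, $\phi^\pm_{i,\pm m}v=\Psi^\pm_{i,\pm m}(u)v$ for all $i\in I,r\in\mathbb Z,m\ge0$. **Fusion.** $\Delta_u:\mathcal U'_q(\hat{\mathfrak g})\to(\mathcal U_q(\hat{\mathfrak g})\otimes_{\mathbb C}\mathcal U_q(\hat{\mathfrak g}))((u))$ is the $\mathbb C(u)$-algebra morphism with $\Delta_u(x^+_{i,r})=x^+_{i,r}\otimes1+\sum_{s\ge0}u^{r+s}(\phi^-_{i,-s}\otimes x^+_{i,r+s})$, $\Delta_u(x^-_{i,r})=u^r(1\otimes x^-_{i,r})+\sum_{s\ge0}u^s(x^-_{i,r-s}\otimes\phi^+_{i,s})$, $\Delta_u(\phi^\pm_{i,\pm m})=\sum_{0\le s\le m}u^{\pm s}(\phi^\pm_{i,\pm(m-s)}\otimes\phi^\pm_{i,\pm s})$, $\Delta_u(k_h)=k_h\otimes k_h$. For $V\in\mathrm{Mod}(\mathcal U_q(\hat{\mathfrak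 g}))$, $i(V)=V\otimes_{\mathbb C}\mathbb C(u)$. $i(V)\otimes_f i(V')$ is $(V\otimes_{\mathbb C}V')\otimes\mathbb C(u)$ with the $\mathcal U'_q(\hat{\mathfrak g})$-action $g.(v\otimes v')=\Delta_u(g)(v\otimes v')$ (the power series in $u$ obtained are expansions of elements of this $\mathbb C(u)$-vector space). *)

(* Defs.v *)
From HB Require Import structures.
From mathcomp Require Import all_boot all_order all_algebra all_fingroup.
From mathcomp Require Import complex.
From mathcomp Require Import reals.

Set Implicit Arguments.
Unset Strict Implicit.
Unset Printing Implicit Defensive.

Import GRing.Theory.

Local Open Scope ring_scope.

Record cartan_datum (n : nat) := CartanDatum {
  cartan :> 'M[int]_n;
  symm : 'I_n -> nat;
  _ : forall i, cartan i i = 2;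
  _ : forall i j, i != j -> cartan i j <= 0;
  _ : forall i j, cartan i j = 0 <-> cartan j i = 0;
  _ : forall i, (0 < symm i)%N;
  _ : forall i j, (symm i)%:Z * cartan i j = (symm j)%:Z * cartan j i
}.

Definition symmetrized (n : nat) (C : cartan_datum n) (i j : 'I_n) : int :=
  (symm C i)%:Z * C i j.

Record realization (n : nat) (C : cartan_datum n) := Realization {
  cartan_space : vectType rat;
  coroot : 'I_n -> cartan_space;
  sroot : 'I_n -> 'Hom(cartan_space, rat^o);
  _ : \dim {: cartan_space} = (2 * n - \rank (map_mx intr C : 'M[rat]_n))%N;
  _ : free [seq coroot i | i : 'I_n];
  _ : free [seq sroot i | i : 'I_n];
  _ : forall i j, sroot j (coroot i) = (C i j)%:~R
}.

Notation weight H := 'Hom(cartan_space H, rat^o).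

Definition in_weight_lattice (n : nat) (C : cartan_datum n)
    (H : realization C) (la : weight H) : Prop :=
  forall i, exists m : int, la (coroot H i) = m%:~R.

(* The set S(la) = la - Q^+. *)
Definition in_cone (n : nat) (C : cartan_datum n) (H : realization C)
    (la om : weight H) : Prop :=
  exists c : 'I_n -> nat, om = la - \sum_i sroot H i *+ c i.

(* A number q which is nonzero and not a root of unity, together with a
   compatible choice [qpow] of its rational powers; q itself is [qpow 1]. *)
Record quantum_parameter (K : fieldType) := QuantumParameter {
  qpow :> rat -> K;
  _ : forall s t, qpow (s + t) = qpow s * qpow t;
  _ : qpow 1 != 0;
  _ : forall m : nat, (0 < m)%N -> qpow 1 ^+ m != 1
}.

Definition qnum (K : fieldType) (q : K) (l : int) : K :=
  (q ^ l - q ^ (- l)) / (q - q^-1).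

Definition qfact (K : fieldType) (q : K) (s : nat) : K :=
  \prod_(1 <= l < s.+1) qnum q l.

Definition qbinom (K : fieldType) (q : K) (s k : nat) : K :=
  qfact q s / (qfact q k * qfact q (s - k)).

Definition opser_one (K : fieldType) (V : lmodType K) (m : nat) (v : V) : V :=
  if m == 0%N then v else 0.

Definition opser_mul (K : fieldType) (V : lmodType K)
    (f g : nat -> V -> V) (m : nat) (v : V) : V :=
  \sum_(j < m.+1) f j (g (m - j)%N v).

(* Coefficient of z^m in exp (f(z)), for a series f without constant term: the
   powers f(z)^p with p > m do not contribute. *)
Definition opser_exp (K : fieldType) (V : lmodType K)
    (f : nat -> V -> V) (m : nat) (v : V) : V :=
  \sum_(p < m.+1)
     ((p : nat)`!%:R)^-1 *: iter p (opser_mul f) (@opser_one K V) m v.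

(* Signs: [true] is +, [false] is -. *)
Definition pm (e : bool) : int := if e then 1 else -1.

(* The actions of the generators x^e_{i,r}, k_h and h_{i,m} on V.  Only the
   h_{i,m} with m != 0 are generators; [op_h i 0] is ignored throughout. *)
Record generator_action (n : nat) (C : cartan_datum n) (H : realization C)
    (K : fieldType) (V : lmodType K) := GeneratorAction {
  op_x : bool -> 'I_n -> int -> {linear V -> V};
  op_k : cartan_space H -> {linear V -> V};
  op_h : 'I_n -> int -> {linear V -> V}
}.

(* The action of phi^e_{i, e m}, for m >= 0. *)
Definition op_phi (n : nat) (C : cartan_datum n) (H : realization C)
    (K : fieldType) (qp : rat -> K) (V : lmodType K)
    (g : generator_action H V) (e : bool) (i : 'I_n) (m : nat) (v : V) : V :=
  op_k g (((pm e)%:~R * (symm C i)%:R) *: coroot H i)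
    (opser_exp
       (fun (p : nat) (w : V) =>
          if p == 0%N then 0
          else ((pm e)%:~R * (qp 1 - (qp 1)^-1))
                 *: op_h g i (pm e * p%:Z) w)
       m v).

(* The action of phi^e_{i,t} for t : int, which is 0 if e t < 0. *)
Definition op_phiz (n : nat) (C : cartan_datum n) (H : realization C)
    (K : fieldType) (qp : rat -> K) (V : lmodType K)
    (g : generator_action H V) (e : bool) (i : 'I_n) (t : int) (v : V) : V :=
  if 0 <= pm e * t then op_phi qp g e i `|t|%N v else 0.

(* The composite f_1 (f_2 (... (f_p v))). *)
Definition op_word (K : fieldType) (V : lmodType K)
    (fs : seq {linear V -> V}) (v : V) : V :=
  foldr (fun (f : {linear V -> V}) w => f w) v fs.

(* Coefficient of w_1^{r_1} ... w_s^{r_s} z^t in the left hand side of the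
   affine quantum Serre relation, s = 1 - C_{i,j}. *)
Definition serre_coef (n : nat) (C : cartan_datum n) (H : realization C)
    (K : fieldType) (qp : rat -> K) (V : lmodType K)
    (g : generator_action H V) (e : bool) (i j : 'I_n)
    (s : nat) (r : 'I_s -> int) (t : int) (v : V) : V :=
  \sum_(p : 'S_s) \sum_(k < s.+1)
    let xs := [seq op_x g e i (r (p a)) | a <- enum 'I_s] in
    ((-1) ^+ k * qbinom (qp (symm C i)%:R) s k)
      *: op_word (take k xs ++ op_x g e j t :: drop k xs) v.

Definition serre_imposed (n : nat) (C : cartan_datum n) : Prop :=
  forall i j, i != j -> C i j * C j i <= 3.

(* The defining relations of the quantum affinization over a field K in which
   q^s is [qp s]; the relations between currents are read off coefficientwise
   (the coefficient of z^(r+1) w^(s+1) for [qaff_xx]). *)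
Record qaff_relations (n : nat) (C : cartan_datum n) (H : realization C)
    (K : fieldType) (qp : rat -> K) (V : lmodType K)
    (g : generator_action H V) : Prop := QaffRelations {
  qaff_kD : forall h h' v, op_k g h (op_k g h' v) = op_k g (h + h') v;
  qaff_k0 : forall v, op_k g 0 v = v;
  qaff_kh : forall h i m v, m != 0 ->
    op_k g h (op_h g i m v) = op_h g i m (op_k g h v);
  qaff_hh : forall i m j p v, m != 0 -> p != 0 ->
    op_h g i m (op_h g j p v) = op_h g j p (op_h g i m v);
  qaff_kx : forall h e j r v,
    op_k g h (op_x g e j r (op_k g (- h) v))
    = qp ((pm e)%:~R * sroot H j h) *: op_x g e j r v;
  qaff_hx : forall i m e j r v, m != 0 ->
    op_h g i m (op_x g e j r v) - op_x g e j r (op_h g i m v)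
    = ((pm e)%:~R * (m%:~R)^-1 * qnum (qp 1) (m * symmetrized C i j))
        *: op_x g e j (m + r) v;
  qaff_pm : forall i r j s v,
    op_x g true i r (op_x g false j s v) - op_x g false j s (op_x g true i r v)
    = if i == j then
        (qp (symm C i)%:R - (qp (symm C i)%:R)^-1)^-1
          *: (op_phiz qp g true i (r + s) v - op_phiz qp g false i (r + s) v)
      else 0;
  qaff_xx : forall e i r j s v,
    op_x g e i (r + 1) (op_x g e j s v)
      - qp (pm e * symmetrized C i j)%:~R
          *: op_x g e i r (op_x g e j (s + 1) v)
    = qp (pm e * symmetrized C i j)%:~R
          *: op_x g e j s (op_x g e i (r + 1) v)
      - op_x g e j (s + 1) (op_x g e i r v);
  qaff_serre : serre_imposed C -> forall e i j, i != j ->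
    forall (r : 'I_(`|1 - C i j|%N) -> int) (t : int) v,
    serre_coef qp g e i j r t v = 0
}.

(* A structure of module over the algebra presented by the generators and
   relations above on the K-vector space V.  For K the field of complex numbers
   this algebra is U_q(g^); for K = C(u) (and q seen in C(u)) it is
   U_q'(g^) = U_q(g^) (x) C(u), which has the same presentation over C(u). *)
Record qaff_module (n : nat) (C : cartan_datum n) (H : realization C)
    (K : fieldType) (qp : rat -> K) (V : lmodType K) := QaffModule {
  qaff_action :> generator_action H V;
  _ : qaff_relations qp qaff_action
}.

(* The submodule U.v generated by v. *)
Inductive cyclic_submodule (n : nat) (C : cartan_datum n) (H : realization C)
    (K : fieldType) (V : lmodType K) (g : generator_action H V) (v : V)
    : V -> Prop :=
| cyclic_gen : cyclic_submodule g v v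
| cyclic_lin : forall (c : K) w1 w2, cyclic_submodule g v w1 ->
    cyclic_submodule g v w2 -> cyclic_submodule g v (c *: w1 + w2)
| cyclic_x : forall e i r w, cyclic_submodule g v w ->
    cyclic_submodule g v (op_x g e i r w)
| cyclic_k : forall h w, cyclic_submodule g v w ->
    cyclic_submodule g v (op_k g h w)
| cyclic_h : forall i m w, m != 0 -> cyclic_submodule g v w ->
    cyclic_submodule g v (op_h g i m w).

Definition weight_vector (n : nat) (C : cartan_datum n) (H : realization C)
    (K : fieldType) (qp : rat -> K) (V : lmodType K)
    (g : generator_action H V) (om : weight H) (v : V) : Prop :=
  forall h, op_k g h v = qp (om h) *: v.

Record in_Mod (n : nat) (C : cartan_datum n) (H : realization C)
    (K : fieldType) (qp : rat -> K) (V : lmodType K)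
    (g : generator_action H V) : Prop := InMod {
  Mod_span : forall v : V,
    exists (N : nat) (om : 'I_N -> weight H) (w : 'I_N -> V),
      (forall a, weight_vector qp g (om a) (w a)) /\ v = \sum_a w a;
  Mod_direct : forall (N : nat) (om : 'I_N -> weight H) (w : 'I_N -> V),
    injective om -> (forall a, weight_vector qp g (om a) (w a)) ->
    \sum_a w a = 0 -> forall a, w a = 0;
  Mod_findim : forall om : weight H,
    exists (N : nat) (b : 'I_N -> V),
      (forall a, weight_vector qp g om (b a)) /\
      forall v, weight_vector qp g om v ->
        exists c : 'I_N -> K, v = \sum_a c a *: b a;
  Mod_cone : exists las : seq (weight H),
    forall (om : weight H) (v : V), weight_vector qp g om v -> v != 0 ->
      exists2 la, la \in las & in_cone la om;
  Mod_integrable : forall (om : weight H) (i : 'I_n),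
    exists N : nat, forall r : nat, (N <= r)%N ->
      forall v, weight_vector qp g (om + sroot H i *+ r) v \/
                weight_vector qp g (om - sroot H i *+ r) v -> v = 0
}.

(* A family Psi = (Psi^e_{i, e m}) over K is stored as [Psi e i m] with
   m : nat. *)
Definition highest_weight_module (n : nat) (C : cartan_datum n)
    (H : realization C) (K : fieldType) (qp : rat -> K) (V : lmodType K)
    (g : generator_action H V) (la : weight H)
    (Psi : bool -> 'I_n -> nat -> K) : Prop :=
  exists v : V,
    [/\ weight_vector qp g la v,
        forall w, cyclic_submodule g v w,
        forall i r, op_x g true i r v = 0
      & forall e i m, op_phi qp g e i m v = Psi e i m *: v].

(* Psi^e_{i,0} = q_i^{e la(alpha_i^vee)}. *)
Definition compatible_weight (n : nat) (C : cartan_datum n)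
    (H : realization C) (K : fieldType) (qp : rat -> K) (la : weight H)
    (Psi : bool -> 'I_n -> nat -> K) : Prop :=
  forall e i,
    Psi e i 0%N = qp ((symm C i)%:R * ((pm e)%:~R * la (coroot H i))).

Definition l_highest_weight (n : nat) (C : cartan_datum n)
    (H : realization C) (K : fieldType) (qp : rat -> K) (V : lmodType K)
    (g : generator_action H V) : Prop :=
  exists (la : weight H) (Psi : bool -> 'I_n -> nat -> K),
    [/\ in_weight_lattice la,
        compatible_weight qp la Psi
      & highest_weight_module qp g la Psi].

Notation ratfun K := {fraction {poly K}}.

Definition ratfunC (K : fieldType) : K -> ratfun K :=
  @tofrac {poly K} \o polyC.

HB.instance Definition _ (K : fieldType) :=
  GRing.RMorphism.copy (@ratfunC K) (@tofrac {poly K} \o polyC).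

Definition ratfunX (K : fieldType) : ratfun K := @tofrac _ 'X.

Definition is_laurent_polynomial (K : fieldType) (f : ratfun K) : Prop :=
  exists (p : {poly K}) (N : nat), f = @tofrac _ p / ratfunX K ^+ N.

Definition lu_highest_weight (n : nat) (C : cartan_datum n)
    (H : realization C) (K : fieldType) (qp : rat -> K)
    (W : lmodType (ratfun K)) (g : generator_action H W) : Prop :=
  exists (la : weight H) (Psi : bool -> 'I_n -> nat -> ratfun K),
    [/\ forall e i m, is_laurent_polynomial (Psi e i m),
        compatible_weight (@ratfunC K \o qp) la Psi
      & highest_weight_module (@ratfunC K \o qp) g la Psi].

(* The family a : int -> K is the Laurent series at u = 0 of the rational
   function f: f = p / d with d a = p in K((u)). *)
Definition laurent_expansion (K : fieldType) (f : ratfun K) (a : int -> K)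
    : Prop :=
  (exists N : int, forall m, m < N -> a m = 0) /\
  exists p d : {poly K},
    [/\ d != 0, f = @tofrac _ p / @tofrac _ d
      & forall m : int, \sum_(k < size d) d`_k * a (m - k%:Z)
                        = if 0 <= m then p`_(`|m|%N) else 0].

Definition is_tensor_product (K : fieldType) (V V' T : lmodType K)
    (tens : {bilinear V -> V' -> T}) : Prop :=
  forall (X : lmodType K) (f : {bilinear V -> V' -> X}),
    (exists F : {linear T -> X}, forall v v', F (tens v v') = f v v') /\
    (forall F G : {linear T -> X},
       (forall v v', F (tens v v') = f v v') ->
       (forall v v', G (tens v v') = f v v') -> F =1 G).

(* W together with ext : T -> W is T (x)_K K(u), ext t being t (x) 1. *)
Definition is_scalar_extension (K : fieldType) (T : lmodType K)
    (W : lmodType (ratfun K))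
    (ext : {linear T -> W | @ratfunC K \; *:%R}) : Prop :=
  forall (X : lmodType (ratfun K))
         (f : {linear T -> X | @ratfunC K \; *:%R}),
    (exists F : {linear W -> X}, forall t, F (ext t) = f t) /\
    (forall F G : {linear W -> X},
       (forall t, F (ext t) = f t) -> (forall t, G (ext t) = f t) -> F =1 G).

(* The element w of T (x) K(u) has the expansion \sum_m (a m) u^m in T((u)). *)
Definition expands_to (K : fieldType) (T : lmodType K)
    (W : lmodType (ratfun K))
    (ext : {linear T -> W | @ratfunC K \; *:%R}) (w : W) (a : int -> T)
    : Prop :=
  exists (N : nat) (f : 'I_N -> ratfun K) (b : 'I_N -> int -> K)
         (t : 'I_N -> T),
    [/\ forall c, laurent_expansion (f c) (b c),
        w = \sum_c f c *: ext (t c)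
      & forall m, a m = \sum_c b c m *: t c].

(* The action on W = (V (x) V') (x) K(u) is g.(v (x) v') = Delta_u(g)(v (x) v').
   In [fusion_xp] and [fusion_xm] the right hand sides are the coefficients of
   u^m; the conventions phi^-_{i,t} = 0 for t > 0 and phi^+_{i,t} = 0 for t < 0
   take care of the condition s >= 0 in the sums defining Delta_u. The action
   of the h_{i,m} is determined by that of the phi^e_{i,m}. *)
Record is_fusion (n : nat) (C : cartan_datum n) (H : realization C)
    (K : fieldType) (qp : rat -> K) (V V' T : lmodType K)
    (g : generator_action H V) (g' : generator_action H V')
    (tens : {bilinear V -> V' -> T})
    (W : lmodType (ratfun K))
    (ext : {linear T -> W | @ratfunC K \; *:%R})
    (gW : generator_action H W) : Prop := IsFusion {
  fusion_xp : forall i r v v',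
    expands_to ext (op_x gW true i r (ext (tens v v')))
      (fun m : int =>
         (if m == 0 then tens (op_x g true i r v) v' else 0)
         + tens (op_phiz qp g false i (r - m) v) (op_x g' true i m v'));
  fusion_xm : forall i r v v',
    expands_to ext (op_x gW false i r (ext (tens v v')))
      (fun m : int =>
         (if m == r then tens v (op_x g' false i r v') else 0)
         + tens (op_x g false i (r - m) v) (op_phiz qp g' true i m v'));
  fusion_phi : forall e i m v v',
    op_phi (@ratfunC K \o qp) gW e i m (ext (tens v v'))
    = \sum_(s < m.+1) ratfunX K ^ (pm e * (s : nat)%:Z)
        *: ext (tens (op_phi qp g e i (m - s)%N v) (op_phi qp g' e i s v'));
  fusion_k : forall h v v',
    op_k gW h (ext (tens v v')) = ext (tens (op_k g h v) (op_k g' h v'))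
}.

(* Main.v *)
From HB Require Import structures.
Require Import Defs.
From mathcomp Require Import all_boot all_order all_algebra.
From mathcomp Require Import complex.
From mathcomp Require Import zify.
From mathcomp Require Import boolp reals.

(** Let v and v' be highest weight vectors of V and V'.  On v (x) v', Delta_u
shows that the x^+_{i,r} vanish and that the phi^e_{i,m} act by Laurent
polynomials in u, namely by the coefficients of the product of the series Psi(z)
and Psi'(uz); the point is that v (x) v' generates the whole fusion product.
Let S be the submodule which it generates over K(u).

For weight vectors w and w' with w (x) w' in S, consider
<<
  x^-_{i,r} (w (x) w') = u^r (w (x) x^-_{i,r} w')
                       + sum_s u^s (x^-_{i,r-s} w (x) phi^+_{i,s} w')
>>
as a function of r.  Since weight spaces are finite-dimensional and h_{i,1},
h_{i,-1} shift r, the sequences x^-_{i,r} w and x^-_{i,r} w' satisfy linear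
recurrences with constant coefficients, given by polynomials P and P'
([x_recurrence]).  The second term then satisfies the recurrence P(z), the first
one P'(uz), and these polynomials are coprime over K(u): the roots of the former
are constants, those of the latter are not ([coprimep_dilate]).  By Bezout
([coprime_conv_mem]) both terms lie in S.

The first term gives w (x) x^-_{i,r} w' in S ([lower_right_mem]).  If w' = v', the
second one is Psi'^+_i(uz) applied to the sequence A_r = x^-_{i,r} w (x) v'.  The
series Psi'^+_i is rational with denominator P', because x^+_{i,0} x^-_{i,r} v' is a
multiple of (phi^+_{i,r} - phi^-_{i,r}) v' ([rational_series]); so N(uz) A lies in
S for some polynomial N with N(0) != 0.  As P(z) A = 0, coprimality again gives
x^-_{i,r} w (x) v' in S ([lower_left_mem]).

Finally V and V' are spanned by words in the x^-_{i,r} applied to v and v'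
([highest_weight_ind]), so S contains all w (x) w', hence everything by the
universal properties of the tensor product and of the extension of scalars.
Computations in the fusion product are made on expansions in u, which determine
the elements ([expands_inj]). *)

Set Implicit Arguments.
Unset Strict Implicit.
Unset Printing Implicit Defensive.

Import Order.TTheory GRing.Theory Num.Theory.

Local Open Scope ring_scope.

(** * Submodules and universal properties *)

Definition is_submodule (K : fieldType) (X : lmodType K) (M : X -> Prop) :=
  M 0 /\ forall (c : K) x y, M x -> M y -> M (c *: x + y).

Section Submodules.
Variables (K : fieldType) (X : lmodType K) (M : X -> Prop).
Hypothesis subM : is_submodule M.

Lemma submodD x y : M x -> M y -> M (x + y).
Proof. by rewrite -{2}[x]scale1r; apply: subM.2. Qed.

Lemma submodZ c x : M x -> M (c *: x).
Proof. by move=> Mx; rewrite -[_ *: _]addr0; apply: subM.2 => //; apply: subM.1. Qed.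

Lemma submodB x y : M x -> M y -> M (x - y).
Proof. by move=> Mx My; apply: submodD => //; rewrite -scaleN1r; apply: submodZ. Qed.

Lemma submod_sum (I : finType) (P : pred I) (F : I -> X) :
  (forall i, P i -> M (F i)) -> M (\sum_(i | P i) F i).
Proof. by move=> MF; elim/big_ind: _ => //; [apply: subM.1 | apply: submodD]. Qed.

Definition submod_pred : {pred X} := fun x => `[< M x >].

Fact submod_pred_closed : submod_closed submod_pred.
Proof.
split=> [|c x y]; rewrite !unfold_in; first exact/asboolP/subM.1.
by move=> /asboolP Mx /asboolP My; apply/asboolP/subM.2.
Qed.

HB.instance Definition _ :=
  GRing.isSubmodClosed.Build K X submod_pred submod_pred_closed.

(** The proof argument lets the linear structure on this subtype be found by
unification. *)
Definition submod_type of is_submodule M := {x : X | x \in submod_pred}.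
HB.instance Definition _ := SubChoice.on (submod_type subM).
HB.instance Definition _ := [SubChoice_isSubLmodule of submod_type subM by <:].

Definition to_submod (Y : Type) (f : Y -> X) (Mf : forall y, M (f y)) (y : Y)
  : submod_type subM := exist _ (f y) (asboolT (Mf y)).

End Submodules.

Section SubmoduleType.
Variables (K : fieldType) (X : lmodType K) (M : X -> Prop).
Hypothesis subM : is_submodule M.

Definition submod_val : {linear submod_type subM -> X} := val.
End SubmoduleType.

(** The bilinear map V x V' -> M induced by tens factors through T; composed with
the inclusion of M it is an endomorphism of T which fixes every tens v v', hence
the identity, so that every t lies in M.  Corestricting to a submodule replaces
the more usual argument with the quotient T / M. *)
Lemma tensor_span (K : fieldType) (V V' T : lmodType K)
    (tens : {bilinear V -> V' -> T}) (M : T -> Prop) :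
  is_tensor_product tens -> is_submodule M ->
  (forall v v', M (tens v v')) -> forall t, M t.
Proof.
move=> tensP subM Mtens t.
pose f v v' : submod_type subM := to_submod subM (Mtens v) v'.
have f_bilin : bilinear_for *:%R *:%R f.
  split=> [v' c v1 v2|v c v1 v2]; apply: val_inj => /=.
    by rewrite linearPl.
  by rewrite linearPr.
pose fB : {bilinear V -> V' -> submod_type subM} :=
  HB.pack f (bilinear_isBilinear.Build _ _ _ _ _ _ f f_bilin).
have [[F FE] _] := tensP _ fB.
have [_ uniqT] := tensP _ tens.
have <- : submod_val subM (F t) = t.
  apply: (uniqT (submod_val subM \o F) idfun) => // v v' /=.
  by rewrite FE.
by case: (F t) => x /= /asboolP.
Qed.

(** Same argument as [tensor_span], for the universal property of T (x) K(u). *)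
Lemma scalar_extension_span (K : fieldType) (T : lmodType K)
    (W : lmodType (ratfun K)) (ext : {linear T -> W | @ratfunC K \; *:%R})
    (M : W -> Prop) :
  is_scalar_extension ext -> is_submodule M ->
  (forall t, M (ext t)) -> forall w, M w.
Proof.
move=> extP subM Mext w.
pose f : T -> submod_type subM := to_submod subM Mext.
have f_lin : linear_for (@ratfunC K \; *:%R) f.
  by move=> c t1 t2; apply: val_inj => /=; rewrite linearP.
pose fL : {linear T -> submod_type subM | @ratfunC K \; *:%R} :=
  HB.pack f (GRing.isLinear.Build _ _ _ _ f f_lin).
have [[F FE] _] := extP _ fL.
have [_ uniqT] := extP _ ext.
have <- : submod_val subM (F w) = w.
  apply: (uniqT (submod_val subM \o F) idfun) => // t /=.
  by rewrite FE.
by case: (F w) => x /= /asboolP.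
Qed.

(** * Polynomials acting on two-sided sequences *)

Section Conv.
Variables (K : fieldType) (X : lmodType K).
Implicit Types (p q : {poly K}) (a b : int -> X).

(** Polynomials act on two-sided sequences as on formal sums of a_m z^m, z being
the shift: conv p a is p(z) a.  Thus conv p a = 0 is a linear recurrence, valid
at all integers; for X = K^o, conv d a is also the product of a polynomial and a
Laurent series. *)
Definition conv p a (m : int) : X := \sum_(k < size p) p`_k *: a (m - k%:Z).

Lemma convEw n p a m :
  (size p <= n)%N -> conv p a m = \sum_(k < n) p`_k *: a (m - k%:Z).
Proof.
move=> le_pn; rewrite /conv (big_ord_widen n (fun k => p`_k *: a (m - k%:Z))) //.
rewrite big_mkcond /=; apply: eq_bigr => k _; case: ltnP => // le_pk.
by rewrite nth_default ?scale0r.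
Qed.

Lemma eq_conv p a b : a =1 b -> conv p a =1 conv p b.
Proof. by move=> ab m; apply: eq_bigr => k _; rewrite ab. Qed.

Lemma convDl p q a m : conv (p + q) a m = conv p a m + conv q a m.
Proof.
rewrite !(@convEw (maxn (size p) (size q))) ?leq_maxl ?leq_maxr ?size_polyD //.
by rewrite -big_split; apply: eq_bigr => k _; rewrite coefD scalerDl.
Qed.

Lemma convZl c p a m : conv (c *: p) a m = c *: conv p a m.
Proof.
rewrite (@convEw (size p)) ?size_scale_leq // scaler_sumr.
by apply: eq_bigr => k _; rewrite coefZ scalerA.
Qed.

Lemma conv0 a m : conv 0 a m = 0.
Proof. by rewrite /conv size_poly0 big_ord0. Qed.

Lemma convC c a m : conv c%:P a m = c *: a m.
Proof. by rewrite (@convEw 1) ?size_polyC_leq1 // big_ord1 coefC /= subr0. Qed.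

Lemma convMX p a m : conv (p * 'X) a m = conv p a (m - 1).
Proof.
rewrite (@convEw (size p).+1) ?(leq_trans (size_polyMleq _ _)) ?size_polyX ?addn2 //.
rewrite big_ord_recl coefMX /= scale0r add0r; apply: eq_bigr => k _.
by rewrite coefMX /= -addrA -opprD -intS.
Qed.

Lemma convM p q a m : conv (p * q) a m = conv p (conv q a) m.
Proof.
elim/poly_ind: p m => [|p c IHp] m; first by rewrite mul0r !conv0.
rewrite mulrDl mul_polyC -mulrA -commr_polyX mulrA !convDl convC.
by rewrite convZl !convMX IHp.
Qed.

Lemma convr0 p m : conv p (fun=> 0) m = 0.
Proof. by rewrite /conv big1 // => k _; rewrite scaler0. Qed.

Lemma convDr p a b m : conv p (fun r => a r + b r) m = conv p a m + conv p b m.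
Proof. by rewrite -big_split; apply: eq_bigr => k _; rewrite scalerDr. Qed.

Lemma convZr p c a m : conv p (fun r => c *: a r) m = c *: conv p a m.
Proof. by rewrite scaler_sumr; apply: eq_bigr => k _; rewrite !scalerA mulrC. Qed.

Lemma conv_mem (M : X -> Prop) p a m :
  is_submodule M -> (forall r, M (a r)) -> M (conv p a m).
Proof.
by move=> subM Ma; apply: (submod_sum subM) => k _; apply: (submodZ subM).
Qed.

(** Bezout: 1 = s p + t q, so a = s (p a) + t (q a).  This separates two sequences
obeying coprime recurrences when only their sum is known to lie in M. *)
Lemma coprime_conv_mem (M : X -> Prop) p q a :
  is_submodule M -> coprimep p q ->
  (forall m, M (conv p a m)) -> (forall m, M (conv q a m)) -> forall m, M (a m).
Proof.
move=> subM /Bezout_coprimepP[[s t] /= /eqpP[[c d] /= /andP[c0 d0] st]] Mp Mq m.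
have: M (d *: a m).
  rewrite -convC -alg_polyC -st convZl convDl !convM.
  by apply: submodZ => //; apply: submodD => //; apply: conv_mem.
by move/(submodZ subM d^-1); rewrite scalerA mulVf // scale1r.
Qed.

(** The shift is invertible on two-sided sequences, so powers of 'X can be
cancelled from a recurrence.  The predicate P makes the resulting polynomial
common to a whole family of sequences. *)
Lemma recurrence_coef0_neq0 (P : (int -> X) -> Prop) p :
  p != 0 -> (forall a m, P a -> conv p a m = 0) ->
  exists2 p1 : {poly K}, p1`_0 != 0 & forall a m, P a -> conv p1 a m = 0.
Proof.
elim/poly_ind: p => [|p c IHp]; first by rewrite eqxx.
have [->|c0] := eqVneq c 0; last first.
  by exists (p * 'X + c%:P) => //; rewrite coefD coefMX coefC add0r.
rewrite addr0 mulf_eq0 polyX_eq0 orbF => p0 Hp; apply: IHp => // a m Pa.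
by rewrite -[m](addrK 1) -convMX Hp.
Qed.

End Conv.

Lemma conv_linear (K : fieldType) (X Y : lmodType K) (f : {linear X -> Y})
    (p : {poly K}) (a : int -> X) m :
  f (conv p a m) = conv p (f \o a) m.
Proof. by rewrite linear_sum; apply: eq_bigr => k _; rewrite linearZ. Qed.

(** For each s, the vectors f s (b_a) are given by N * M coordinates on the b'_j;
so the values s = 0, -1, ..., - N * M provide (N * M).+1 linearly dependent
vectors of coordinates. *)
Lemma exists_recurrence (K : fieldType) (X Y : lmodType K) (N M : nat)
    (b : 'I_N -> X) (b' : 'I_M -> Y) (f : int -> X -> Y) :
  (forall s a, exists c : 'I_M -> K, f s (b a) = \sum_j c j *: b' j) ->
  exists2 p : {poly K}, p != 0 & forall a, conv p (f^~ (b a)) 0 = 0.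
Proof.
move=> fb.
have [c fE] : exists c : int -> 'I_N -> 'I_M -> K,
    forall s a, f s (b a) = \sum_j c s a j *: b' j.
  have [c cP] := choice (fun sa : int * 'I_N => fb sa.1 sa.2).
  by exists (fun s a => c (s, a)) => s a; rewrite (cP (s, a)).
pose A : 'M[K]_((N * M).+1, N * M) :=
  \matrix_k mxvec (\matrix_(a, j) c (0 - k%:Z) a j).
have /rowV0Pn[u /sub_kermxP uA u0] : kermx A != 0.
  by rewrite kermx_eq0 /row_free neq_ltn ltnS rank_leq_col.
exists (rVpoly u).
  by apply: contraNneq u0 => p0; rewrite -[u]rVpolyK p0 linear0.
move=> a; rewrite (convEw _ _ (size_poly _ _)).
under eq_bigr => k _ do rewrite coef_rVpoly_ord fE scaler_sumr.
rewrite exchange_big big1 //= => j _.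
under eq_bigr => k _ do rewrite scalerA.
have /rowP/(_ (mxvec_index a j)) := uA; rewrite !mxE => uAaj.
rewrite -scaler_suml [X in X *: _](_ : _ = 0) ?scale0r // -[RHS]uAaj.
by apply: eq_bigr => k _; rewrite mxE mxvecE mxE.
Qed.

(** * Dilated polynomials *)

(** The polynomial p(uX): it gives the recurrence of the sequence u^m a_m when p
gives that of a_m. *)
Definition dilate (K : fieldType) (p : {poly K}) : {poly ratfun K} :=
  \poly_(k < size p) (ratfunC p`_k * ratfunX K ^+ k).

Lemma ratfunX_neq0 (K : fieldType) : ratfunX K != 0.
Proof. by rewrite tofrac_eq0 polyX_eq0. Qed.

(** The value of p(uX) at a constant c is the polynomial p(cu) of u, whose constant
term is that of p. *)
Lemma dilate_nonroot (K : fieldType) (p : {poly K}) (c : K) :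
  p`_0 != 0 -> ~~ root (dilate p) (ratfunC c).
Proof.
move=> p0; rewrite rootE horner_poly.
have -> : \sum_(k < size p) ratfunC p`_k * ratfunX K ^+ k * ratfunC c ^+ k
    = @tofrac _ (\poly_(k < size p) (p`_k * c ^+ k)).
  rewrite poly_def rmorph_sum; apply: eq_bigr => k _.
  rewrite -mul_polyC !rmorphM !rmorphXn /= mulrAC.
  by rewrite /ratfunC /= .
rewrite tofrac_eq0; apply: contraNneq p0 => /(congr1 (fun r : {poly K} => r`_0)).
rewrite coef_poly coef0 expr0 mulr1; case: ltnP => [_ /eqP //|s0 _].
by rewrite nth_default.
Qed.

(** The roots of p are constants, since K is algebraically closed, and p'(uX) has no
constant root. *)
Lemma coprimep_dilate (K : closedFieldType) (p p' : {poly K}) :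
  p != 0 -> p'`_0 != 0 -> coprimep (map_poly (@ratfunC K) p) (dilate p').
Proof.
move=> p0 p'0; have [s ->] := closed_field_poly_normal p.
rewrite linearZ /= coprimepZl ?fmorph_eq0 ?lead_coef_eq0 // coprimep_sym.
rewrite rmorph_prod /=; elim: s => [|c s IHs]; first by rewrite big_nil coprimep1.
rewrite big_cons coprimepMr IHs andbT rmorphB /= map_polyX map_polyC /= coprimep_XsubC.
exact: dilate_nonroot.
Qed.

(** * Expansions in u *)

Section LaurentExpansion.
Variable K : fieldType.
Implicit Types (p d : {poly K}) (f g : ratfun K) (a b : int -> K^o).

Definition coefz p (m : int) : K^o := if 0 <= m then p`_(`|m|%N) else 0.

Lemma coefzD p d m : coefz (p + d) m = coefz p m + coefz d m.
Proof. by rewrite /coefz; case: ifP; rewrite ?coefD ?addr0. Qed.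

Lemma coefzZ c p m : coefz (c *: p) m = c *: coefz p m.
Proof. by rewrite /coefz; case: ifP; rewrite ?coefZ ?scaler0. Qed.

Lemma coefzMX p m : coefz (p * 'X) m = coefz p (m - 1).
Proof.
rewrite /coefz coefMX; case: (lerP 0 (m - 1)) => [m1|m1].
  have -> : 0 <= m by lia.
  have -> : `|m - 1|%N = `|m|%N.-1 by lia.
  by have -> : (`|m|%N == 0%N) = false by lia.
by case: ifP => // m0; have -> : `|m|%N = 0%N by lia.
Qed.

Lemma conv_coefz d p m : conv d (coefz p) m = coefz (d * p) m.
Proof.
elim/poly_ind: d m => [|d c IHd] m.
  by rewrite mul0r conv0 /coefz coef0 if_same.
rewrite convDl convMX convC IHd mulrDl mul_polyC -mulrA -commr_polyX mulrA.
by rewrite coefzD coefzMX coefzZ.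
Qed.

Lemma laurent_expansionP f a :
  laurent_expansion f a <->
  (exists N : int, forall m, m < N -> a m = 0) /\
  exists p d, [/\ d != 0, f = @tofrac _ p / @tofrac _ d & conv d a =1 coefz p].
Proof. by []. Qed.

Lemma laurent_expansionD f g a b :
  laurent_expansion f a -> laurent_expansion g b ->
  laurent_expansion (f + g) (fun m => a m + b m).
Proof.
move=> /laurent_expansionP[[N aN] [p [d [d0 -> Ea]]]].
move=> /laurent_expansionP[[N' bN'] [p' [d' [d'0 -> Eb]]]].
apply/laurent_expansionP; split.
  by exists (Num.min N N') => m; rewrite lt_min => /andP[/aN -> /bN' ->]; rewrite addr0.
exists (p * d' + p' * d), (d * d'); split; first by rewrite mulf_neq0.
  by rewrite addf_div ?tofrac_eq0 // !(rmorphM, rmorphD).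
move=> m; rewrite convDr coefzD; congr (_ + _).
  by rewrite mulrC convM (eq_conv _ Ea) conv_coefz mulrC.
by rewrite convM (eq_conv _ Eb) conv_coefz mulrC.
Qed.

Lemma laurent_expansionZ c z f a :
  laurent_expansion f a ->
  laurent_expansion (ratfunC c * ratfunX K ^ z * f) (fun m => c * a (m - z)).
Proof.
have laurentC g b :
    laurent_expansion g b -> laurent_expansion (ratfunC c * g) (fun m => c * b m).
  move=> /laurent_expansionP[[N bN] [p [d [d0 -> Eb]]]]; apply/laurent_expansionP.
  split; first by exists N => m /bN ->; rewrite mulr0.
  exists (c *: p), d; split=> // [|m]; last by rewrite convZr Eb coefzZ.
  by rewrite -mul_polyC rmorphM mulrA.
have laurentX g b :
    laurent_expansion g b -> laurent_expansion (ratfunX K * g) (fun m => b (m - 1)).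
  move=> /laurent_expansionP[[N bN] [p [d [d0 -> Eb]]]]; apply/laurent_expansionP.
  split; first by exists (N + 1) => m mN; rewrite bN // ltrBlDr.
  exists (p * 'X), d; split=> // [|m].
    by rewrite rmorphM mulrA [_ * ratfunX K]mulrC.
  rewrite coefzMX -Eb -convMX convM; apply: eq_conv => r.
  by rewrite -['X]mul1r convMX convC scale1r.
have laurentV g b :
    laurent_expansion g b ->
    laurent_expansion ((ratfunX K)^-1 * g) (fun m => b (m + 1)).
  move=> /laurent_expansionP[[N bN] [p [d [d0 -> Eb]]]]; apply/laurent_expansionP.
  split; first by exists (N - 1) => m mN; rewrite bN // -ltrBrDr.
  exists p, (d * 'X); split; first by rewrite mulf_neq0 ?polyX_eq0.
    by rewrite rmorphM invfM [RHS]mulrA [LHS]mulrC.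
  by move=> m; rewrite convMX -Eb; apply: eq_bigr => k _; rewrite addrAC subrK.
move=> fa; rewrite -mulrA; apply: (laurentC _ (fun m => a (m - z))).
elim: z => [|k IHk|k IHk].
- rewrite expr0z mul1r; congr laurent_expansion: fa.
  by apply/funext => m; rewrite subr0.
- rewrite -addn1 PoszD addrC expfzDr ?ratfunX_neq0 // expr1z -mulrA.
  congr laurent_expansion: (laurentX _ _ IHk).
  by apply/funext => m; rewrite opprD addrA.
- rewrite -addn1 PoszD addrC opprD expfzDr ?ratfunX_neq0 // exprN1 -mulrA.
  congr laurent_expansion: (laurentV _ _ IHk).
  by apply/funext => m; rewrite opprD addrA !opprK.
Qed.

Lemma laurent_expansion1 : laurent_expansion 1 (fun m => (m == 0)%:R : K).
Proof.
apply/laurent_expansionP; split.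
  by exists 0 => m m0; rewrite lt_eqF.
exists 1, 1; split; rewrite ?oner_eq0 ?divr1 // => m.
rewrite convC scale1r /coefz coef1.
by case: m => [[|m]|m].
Qed.

Lemma laurent_expansion_eq0 f a :
  laurent_expansion f a -> (forall m, a m = 0) -> f = 0.
Proof.
move=> /laurent_expansionP[_ [p [d [d0 -> Ea]]]] a0; suff -> : p = 0.
  by rewrite rmorph0 mul0r.
apply/polyP => k; have := Ea k; rewrite /coefz /= => <-.
by rewrite coef0 (eq_conv d a0) convr0.
Qed.

End LaurentExpansion.

Section Expansion.
Variables (K : fieldType) (T : lmodType K) (W : lmodType (ratfun K)).
Variable ext : {linear T -> W | @ratfunC K \; *:%R}.
Implicit Types (w : W) (a : int -> T).

Lemma eq_expands w a b : a =1 b -> expands_to ext w a -> expands_to ext w b.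
Proof. by move=> /funext ->. Qed.

Lemma expandsD w1 w2 a1 a2 :
  expands_to ext w1 a1 -> expands_to ext w2 a2 ->
  expands_to ext (w1 + w2) (fun m => a1 m + a2 m).
Proof.
move=> [N1 [f1 [b1 [t1 [L1 -> E1]]]]] [N2 [f2 [b2 [t2 [L2 -> E2]]]]].
pose glue A (x1 : 'I_N1 -> A) (x2 : 'I_N2 -> A) c :=
  match split c with inl i => x1 i | inr j => x2 j end.
have glueL A x1 x2 i : @glue A x1 x2 (lshift N2 i) = x1 i.
  by rewrite /glue (unsplitK (inl i)).
have glueR A x1 x2 j : @glue A x1 x2 (rshift N1 j) = x2 j.
  by rewrite /glue (unsplitK (inr j)).
exists (N1 + N2)%N, (glue _ f1 f2), (glue _ b1 b2), (glue _ t1 t2); split.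
- by move=> c; rewrite /glue; case: (split c).
- by rewrite big_split_ord; congr (_ + _); apply: eq_bigr => c _; rewrite ?glueL ?glueR.
- move=> m; rewrite E1 E2 big_split_ord.
  by congr (_ + _); apply: eq_bigr => c _; rewrite ?glueL ?glueR.
Qed.

Lemma expandsZ c z w a :
  expands_to ext w a ->
  expands_to ext ((ratfunC c * ratfunX K ^ z) *: w) (fun m => c *: a (m - z)).
Proof.
move=> [N [f [b [t [L -> E]]]]].
exists N, (fun i => ratfunC c * ratfunX K ^ z * f i),
  (fun i m => c * b i (m - z)), t; split.
- by move=> i; apply: laurent_expansionZ.
- by rewrite scaler_sumr; apply: eq_bigr => i _; rewrite scalerA.
- by move=> m; rewrite E scaler_sumr; apply: eq_bigr => i _; rewrite scalerA.
Qed.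

Lemma expands_ext t : expands_to ext (ext t) (fun m => if m == 0 then t else 0).
Proof.
exists 1%N, (fun=> 1), (fun _ m => (m == 0)%:R), (fun=> t); split.
- by move=> _; apply: laurent_expansion1.
- by rewrite big_ord1 scale1r.
- by move=> m; rewrite big_ord1; case: eqP; rewrite ?scale1r ?scale0r.
Qed.

Lemma expands_sum (n : nat) (w : 'I_n -> W) (a : 'I_n -> int -> T) :
  (forall k, expands_to ext (w k) (a k)) ->
  expands_to ext (\sum_k w k) (fun m => \sum_k a k m).
Proof.
elim: n w a => [|n IHn] w a wa.
  exists 0%N, (fun=> 0), (fun _ _ => 0), (fun=> 0).
  by split=> [[]||m] //=; rewrite !big_ord0.
rewrite big_ord_recl.
apply: (eq_expands (a := fun m => a ord0 m + \sum_k a (lift ord0 k) m)).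
  by move=> m; rewrite big_ord_recl.
exact: expandsD (wa ord0) (IHn _ _ (fun k => wa (lift ord0 k))).
Qed.

(** This is the injectivity of T (x) K(u) -> T((u)).  Induction on the number of
terms of the sum of the f_c (x) t_c: if some coefficient b_c(m) is nonzero, then
the vanishing of the coefficient of u^m expresses t_c through the other t_i and
one term can be eliminated; otherwise all the f_c have a zero expansion. *)
Lemma expands_eq0 w a : expands_to ext w a -> (forall m, a m = 0) -> w = 0.
Proof.
move=> [N [f [b [t [L -> E]]]]] a0.
have {E a0} : forall m, \sum_c b c m *: t c = 0 by move=> m; rewrite -E.
elim: N f b t L => [|N IHN] f b t L E; first by rewrite big_ord0.
have [[c [m bcm]]|b0] := pselect (exists c m, b c m != 0); last first.
  rewrite big1 // => c _; rewrite (laurent_expansion_eq0 (L c)) ?scale0r // => m.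
  by apply/eqP/negPn/negP => bcm; apply: b0; exists c, m.
pose lam i := b (lift c i) m / b c m.
have tc : t c = - \sum_i lam i *: t (lift c i).
  have := E m; rewrite (bigD1_ord c) //= => /eqP; rewrite addr_eq0 => /eqP Ec.
  rewrite -[t c](scalerK bcm) Ec scalerN scaler_sumr; congr (- _).
  by apply: eq_bigr => i _; rewrite scalerA mulrC.
pose f' i := f (lift c i) + ratfunC (- lam i) * ratfunX K ^ 0 * f c.
pose b' i r := b (lift c i) r + (- lam i) * b c (r - 0).
have := IHN f' b' (t \o lift c).
rewrite (bigD1_ord c) //= tc linearN linear_sum scalerN scaler_sumr -sumrN.
rewrite -big_split /= => IH; rewrite -[RHS]IH; first last.
- move=> r; have := E r; rewrite (bigD1_ord c) //= tc scalerN scaler_sumr -sumrN.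
  rewrite -big_split /= => Er; rewrite -[RHS]Er; apply: eq_bigr => i _.
  by rewrite /b' subr0 scalerDl mulNr scaleNr scalerA mulrC addrC.
- by move=> i; apply: laurent_expansionD => //; apply: laurent_expansionZ.
apply: eq_bigr => i _.
rewrite /f' scalerDl addrC; congr (_ + _).
rewrite expr0z mulr1 rmorphN mulNr scaleNr mulrC.
rewrite -[in RHS]scalerA ?scalerN; congr (- (_ *: _)); exact: linearZ.
Qed.

(** Identities in W can therefore be checked on the expansions given by Delta_u. *)
Lemma expands_inj w1 w2 a : expands_to ext w1 a -> expands_to ext w2 a -> w1 = w2.
Proof.
move=> E1 E2; apply/eqP; rewrite -subr_eq0; apply/eqP.
have := expandsD E1 (expandsZ (-1) 0 E2).
rewrite expr0z mulr1 rmorphN1 scaleN1r => /expands_eq0; apply=> m.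
by rewrite subr0 scaleN1r subrr.
Qed.

End Expansion.

Section ExpansionConv.
Variables (K : fieldType) (T : lmodType K) (W : lmodType (ratfun K)).
Variable ext : {linear T -> W | @ratfunC K \; *:%R}.
Variables (p : {poly K}) (B : int -> W) (b : int -> int -> T).
Hypothesis Bb : forall r, expands_to ext (B r) (b r).

Lemma expands_conv r :
  expands_to ext (conv (map_poly (@ratfunC K) p) B r)
    (fun m => \sum_(k < size p) p`_k *: b (r - k%:Z) m).
Proof.
rewrite /conv size_map_poly.
apply: (eq_expands (a := fun m => \sum_(k < size p) p`_k *: b (r - k%:Z) (m - 0))).
  by move=> m; rewrite subr0.
apply: (expands_sum (a := fun k m => p`_k *: b (r - k%:Z) (m - 0))) => k.
have := expandsZ p`_k 0 (Bb (r - k%:Z)); congr expands_to.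
by rewrite expr0z mulr1 coef_map.
Qed.

Lemma expands_conv_dilate r :
  expands_to ext (conv (dilate p) B r)
    (fun m => \sum_(k < size p) p`_k *: b (r - k%:Z) (m - k%:Z)).
Proof.
rewrite (convEw _ _ (size_poly _ _)).
apply: (expands_sum (a := fun k m => p`_k *: b (r - k%:Z) (m - k%:Z))) => k.
have := expandsZ p`_k k%:Z (Bb (r - k%:Z)); congr expands_to.
by rewrite coef_poly ltn_ord.
Qed.

End ExpansionConv.

(** * Exponentials of operator series *)

Section OperatorSeries.
Variables (K : fieldType) (V : lmodType K) (S : V -> Prop).
Hypothesis subS : is_submodule S.
Variable f : nat -> V -> V.

Lemma opser_iter_mem t m v :
  (forall j w, (j <= m)%N -> S w -> S (f j w)) -> S v ->
  S (iter t (opser_mul f) (@opser_one K V) m v).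
Proof.
move=> Sf Sv; elim: t m Sf => [|t IHt] m Sf.
  by rewrite /= /opser_one; case: eqP => // _; apply: subS.1.
apply: submod_sum => // j _; apply: (Sf); first by rewrite -ltnS.
by apply: IHt => k w km; apply: (Sf); rewrite (leq_trans km) ?leq_subr.
Qed.

Lemma opser_exp_mem m v :
  (forall j w, S w -> S (f j w)) -> S v -> S (opser_exp f m v).
Proof.
move=> Sf Sv; apply: submod_sum => // t _; apply: submodZ => //.
by apply: opser_iter_mem => // j w _; apply: (Sf).
Qed.

(** The coefficient of z^m in exp (f(z)) is f_m plus products of several f_j with
0 < j < m, because f(z) has no constant term. *)
Lemma opser_exp_lead_mem m v :
  (0 < m)%N -> (forall w, f 0 w = 0) -> (forall j, f j 0 = 0) ->
  (forall j w, (j < m)%N -> S w -> S (f j w)) -> S v ->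
  S (opser_exp f m v - f m v).
Proof.
move=> m0 f0 fj0 Sf Sv; case: m m0 Sf => // m _ Sf.
rewrite /opser_exp big_ord_recl /= fact0 invr1 scale1r /opser_one /= add0r.
rewrite big_ord_recl /= invr1 scale1r {1}/opser_mul big_ord_recr /= subnn /=.
rewrite big1 => [|j _]; last by rewrite /opser_one subn_eq0 leqNgt ltn_ord fj0.
rewrite add0r addrAC addrC subrr addr0; apply: submod_sum => // t _.
apply: submodZ => //; rewrite {1}/opser_mul big_ord_recr big_ord_recl /=.
rewrite f0 add0r subnn; apply: submodD => //; last first.
  by rewrite {1}/opser_mul big_ord1 f0 fj0; apply: subS.1.
apply: submod_sum => // j _; apply: (Sf); first by rewrite /= ltnS ltn_ord.
rewrite -[opser_mul f _]/(iter t.+1 (opser_mul f) (@opser_one K V)).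
apply: opser_iter_mem => // k w km; apply: (Sf).
by rewrite ltnS (leq_trans km) //= subSS leq_subr.
Qed.

End OperatorSeries.

(** * Powers of q *)

Section QuantumParameter.
Variables (K : fieldType) (q : quantum_parameter K).

Lemma qpowD s t : q (s + t) = q s * q t.
Proof. by case: q => f /=. Qed.

Lemma qpow0 : q 0 = 1.
Proof.
have q1 : q 1 != 0 by case: q.
by apply: (mulfI q1); rewrite -qpowD addr0 mulr1.
Qed.

Lemma qpow_neq0 s : q s != 0.
Proof.
apply: contraNneq (oner_neq0 K) => qs.
by rewrite -qpow0 -(subrr s) qpowD qs mul0r.
Qed.

Lemma qpow_nat m : q m%:R = q 1 ^+ m.
Proof.
by elim: m => [|m IHm]; rewrite ?qpow0 // -natr1 qpowD IHm exprSr.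
Qed.

Lemma qpowX_neq1 m : (0 < m)%N -> q 1 ^+ m != 1.
Proof. by case: q => f /= _ _; apply. Qed.

Lemma qpow_sub_inv_neq0 m : (0 < m)%N -> q m%:R - (q m%:R)^-1 != 0.
Proof.
move=> m0; rewrite subr_eq0; apply: contraTneq (qpowX_neq1 (m := m * 2) _).
  by move=> E; rewrite exprM -qpow_nat negbK expr2 {1}E mulVf ?qpow_neq0.
by rewrite muln_gt0 m0.
Qed.

Lemma qnum_neq0 (l : int) : l != 0 -> qnum (q 1) l != 0.
Proof.
have q1 := qpow_neq0 1.
have num m : (0 < m)%N -> q 1 ^ m%:Z - q 1 ^ (- m%:Z) != 0.
  by move=> m0; rewrite -exprnN -exprnP -qpow_nat qpow_sub_inv_neq0.
move=> l0; rewrite /qnum mulf_neq0 // ?invr_eq0 ?(qpow_sub_inv_neq0 (m := 1)) //.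
case: l l0 => [[|m]|m] // _; first exact: num.
by rewrite NegzE opprK -oppr_eq0 opprB num.
Qed.

End QuantumParameter.

(** * Highest weight modules *)

Section QuantumAffinization.
Variables (n : nat) (C : cartan_datum n) (H : realization C).
Variables (K : fieldType) (q : quantum_parameter K).

Lemma symm_gt0 i : (0 < symm C i)%N.
Proof. by case: C. Qed.

Lemma symmetrized_diag_neq0 i : symmetrized C i i != 0.
Proof.
rewrite /symmetrized (_ : C i i = 2); last by case: C.
by rewrite mulf_neq0 // eqz_nat -lt0n symm_gt0.
Qed.

Section Module.
Variables (V : lmodType K) (g : generator_action H V).
Hypothesis rel : qaff_relations q g.
Implicit Types (v w : V) (om la : weight H).

Lemma op_kK h v : op_k g (- h) (op_k g h v) = v.
Proof. by rewrite (qaff_kD rel) addNr (qaff_k0 rel). Qed.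

Lemma op_kx h e j r v :
  op_k g h (op_x g e j r v)
  = q ((pm e)%:~R * sroot H j h) *: op_x g e j r (op_k g h v).
Proof. by rewrite -(qaff_kx rel) op_kK. Qed.

Lemma weight_x om i r w :
  weight_vector q g om w ->
  weight_vector q g (om - sroot H i) (op_x g false i r w).
Proof.
move=> ww h; rewrite op_kx ww linearZ scalerA -qpowD mulN1r addrC.
by rewrite add_lfunE opp_lfunE.
Qed.

Lemma weight_h om i m w :
  m != 0 -> weight_vector q g om w -> weight_vector q g om (op_h g i m w).
Proof. by move=> m0 ww h; rewrite (qaff_kh rel) // ww linearZ. Qed.

(** The operators h_{i,1} and h_{i,-1} shift the index r of x^-_{i,r}, as the
scalar [+-2 r_i]_q in their commutation relation is nonzero. *)
Lemma x_shift i e :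
  exists2 c, c != 0 & forall r w,
    op_h g i (pm e) (op_x g false i r w) - op_x g false i r (op_h g i (pm e) w)
    = c *: op_x g false i (pm e + r) w.
Proof.
have pm0 : pm e != 0 by case: e.
have pmK : (pm e)%:~R != 0 :> K.
  by case: e {pm0}; rewrite /= ?oner_eq0 // mulrN1z oppr_eq0 oner_eq0.
eexists; last by move=> r w; rewrite (qaff_hx rel).
apply: mulf_neq0; last by rewrite qnum_neq0 // mulf_neq0 ?symmetrized_diag_neq0.
by apply: mulf_neq0; rewrite ?invr_eq0 // mulrN1z oppr_eq0 oner_eq0.
Qed.

(** The x^-_{i,r} map one finite-dimensional weight space into another, so there is
a linear dependence between finitely many of them; commuting it with h_{i,1} and
h_{i,-1}, which preserve the weight space, shifts it to all indices. *)
Lemma x_recurrence om i :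
  in_Mod q g ->
  exists2 p : {poly K}, p`_0 != 0 & forall w, weight_vector q g om w ->
    forall r, conv p (fun s => op_x g false i s w) r = 0.
Proof.
move=> gMod.
have [N [b [bw bgen]]] := Mod_findim gMod om.
have [M [b' [_ bgen']]] := Mod_findim gMod (om - sroot H i).
have [|p p0 pb] :=
  @exists_recurrence K V V N M b b' (fun s w => op_x g false i s w).
  by move=> s a; apply/bgen'/weight_x/bw.
(* The cancellation of powers of 'X must be uniform in w. *)
pose P (a : int -> V) := exists2 w, weight_vector q g om w &
  a = (fun s => op_x g false i s w).
suff pP a m : P a -> conv p a m = 0.
  have [p1 p10 p1P] := recurrence_coef0_neq0 p0 pP.
  by exists p1 => // w ww r; apply: p1P; exists w.
move=> [w ww ->] {a}.
have base u : weight_vector q g om u -> conv p (fun s => op_x g false i s u) 0 = 0.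
  move=> /bgen[c ->]; rewrite /conv.
  under eq_bigr => k _ do rewrite linear_sum scaler_sumr.
  rewrite exchange_big big1 //= => a _.
  under eq_bigr => k _ do rewrite linearZ scalerA mulrC -scalerA.
  by rewrite -scaler_sumr [X in _ *: X]pb scaler0.
(* From the index r to r + 1 or r - 1, by commutation with h_{i,1} or h_{i,-1}. *)
have step e r :
    (forall u, weight_vector q g om u -> conv p (fun s => op_x g false i s u) r = 0) ->
    forall u, weight_vector q g om u ->
    conv p (fun s => op_x g false i s u) (pm e + r) = 0.
  move=> IH u uw; have [c c0 cE] := x_shift i e.
  apply: (scalerI c0); rewrite scaler0 -convZr.
  transitivity (op_h g i (pm e) (conv p (fun s => op_x g false i s u) r)
      - conv p (fun s => op_x g false i s (op_h g i (pm e) u)) r); last first.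
    by rewrite !IH ?linear0 ?addr0 //; apply: weight_h => //; case: e {cE}.
  rewrite conv_linear -sumrB; apply: eq_bigr => k _.
  by rewrite -addrA -cE scalerBr.
have [k] : exists k : nat, (`|m| <= k)%N by exists `|m|%N.
elim: k m w ww => [|k IHk] m w ww mk; first by rewrite (_ : m = 0) ?base //; lia.
have [m0|m0] := lerP 0 m.
  have [->|mn0] := eqVneq m 0; first exact: base.
  rewrite -[m](subrKC 1); apply: (step true) => // u uw; apply: IHk => //; lia.
rewrite -[m](subrKC (-1)); apply: (step false) => // u uw; apply: IHk => //; lia.
Qed.

Section HighestWeight.
Variables (v : V) (la : weight H) (Psi : bool -> 'I_n -> nat -> K).
Hypothesis v_weight : weight_vector q g la v.
Hypothesis v_cyclic : forall w, cyclic_submodule g v w.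
Hypothesis v_x : forall i r, op_x g true i r v = 0.
Hypothesis v_phi : forall e i m, op_phi q g e i m v = Psi e i m *: v.

Lemma line_submodule : is_submodule (fun w => exists c : K, w = c *: v).
Proof.
split=> [|c _ _ [a ->] [b ->]]; first by exists 0; rewrite scale0r.
by exists (c * a + b); rewrite scalerDl scalerA.
Qed.

(** The vector v is an eigenvector of the phi^e_{i,m} by definition, but the
commutation of h_{i,m} with x^- requires it to be one for the h_{i,m} too.  The
latter are recovered from the former by induction on m: up to an operator k_h,
phi^e_{i,m} is a nonzero multiple of h_{i,e m} plus a polynomial in the
h_{i,e j} with 0 < j < m. *)
Lemma op_h_highest i m : m != 0 -> exists c, op_h g i m v = c *: v.
Proof.
suff {m} hv e p : (0 < p)%N -> exists c, op_h g i (pm e * p%:Z) v = c *: v.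
  case: m => [[|m]|m] // _.
    by have := hv true m.+1 isT; rewrite mul1r.
  by have := hv false m.+1 isT; rewrite mulN1r NegzE.
have kappa : (pm e)%:~R * (q 1 - (q 1)^-1) != 0.
  rewrite mulf_neq0 ?(qpow_sub_inv_neq0 q (m := 1)) //.
  by case: e; rewrite /= ?oner_eq0 // mulrN1z oppr_eq0 oner_eq0.
set kap := (_ * _) in kappa.
have [p'] := ubnP p; elim: p' p => // p' IHp p lt_pp' p0.
pose f j (w : V) := if j == 0%N then 0 else kap *: op_h g i (pm e * j%:Z) w.
suff [c fc] : exists c, f p v = c *: v.
  exists (kap^-1 * c); rewrite -scalerA -fc /f -if_neg -lt0n p0 scalerA.
  by rewrite mulVf // scale1r.
have fj0 j : f j 0 = 0 by rewrite /f; case: ifP; rewrite // linear0 scaler0.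
have [c Ec] : exists c, opser_exp f p v = c *: v.
  set h := ((pm e)%:~R * (symm C i)%:R) *: coroot H i.
  have /(congr1 (op_k g (- h))) := v_phi e i p; rewrite /op_phi -/h op_kK.
  by rewrite -/f => ->; rewrite linearZ /= v_weight scalerA; eexists.
have [|||d] := @opser_exp_lead_mem _ _ _ line_submodule f p v p0 _ fj0.
- by [].
- move=> j w jp [a ->]; rewrite /f; case: eqP => [_|/eqP].
    by exists 0; rewrite scale0r.
  rewrite -lt0n => j0; have [b Eb] := IHp j (leq_trans jp lt_pp') j0.
  by exists (kap * (a * b)); rewrite linearZ Eb !scalerA mulrA.
- by exists 1; rewrite scale1r.
rewrite Ec => fpE; exists (c - d).
by rewrite scalerBl -fpE opprB subrKC.
Qed.

Inductive lower_word : V -> Prop :=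
| lower_word0 : lower_word v
| lower_wordx i r w : lower_word w -> lower_word (op_x g false i r w).

Definition lower_span w :=
  forall S : V -> Prop, is_submodule S -> (forall u, lower_word u -> S u) -> S w.

Lemma lower_span_submodule : is_submodule lower_span.
Proof.
split=> [S subS _|c x y Sx Sy S subS wS]; first exact: subS.1.
by apply: subS.2; [apply: Sx | apply: Sy].
Qed.

Lemma lower_span_word u : lower_word u -> lower_span u.
Proof. by move=> uw S _; apply. Qed.

Lemma lower_word_weight u : lower_word u -> exists om, weight_vector q g om u.
Proof.
elim=> [|i r w _ [om ww]]; first by exists la.
by exists (om - sroot H i); apply: weight_x.
Qed.

Lemma lower_span_linear (f : {linear V -> V}) w :
  (forall u, lower_word u -> lower_span (f u)) ->
  lower_span w -> lower_span (f w).
Proof.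
move=> fu wS; apply: (wS (fun w => lower_span (f w))) => //.
have subL := lower_span_submodule.
split=> [|c x y]; first by rewrite linear0; apply: subL.1.
by rewrite linearP; apply: subL.2.
Qed.

Lemma lower_span_k h w : lower_span w -> lower_span (op_k g h w).
Proof.
apply: lower_span_linear => u uw; have [om ->] := lower_word_weight uw.
by apply: (submodZ lower_span_submodule); apply: lower_span_word.
Qed.

Lemma lower_span_xm i r w : lower_span w -> lower_span (op_x g false i r w).
Proof.
by apply: lower_span_linear => u uw; apply: lower_span_word; apply: lower_wordx.
Qed.

Lemma lower_span_h i m w : m != 0 -> lower_span w -> lower_span (op_h g i m w).
Proof.
move=> m0; apply: lower_span_linear => u; elim=> [|j r x xw IHx].
  have [c ->] := op_h_highest i m0; apply: (submodZ lower_span_submodule).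
  exact: (lower_span_word lower_word0).
have /(canRL (subrK _)) -> := qaff_hx rel i false j r x m0.
apply: (submodD lower_span_submodule); last exact: lower_span_xm.
apply: (submodZ lower_span_submodule).
by apply: lower_span_word; apply: lower_wordx.
Qed.

Lemma lower_span_phiz e i t w : lower_span w -> lower_span (op_phiz q g e i t w).
Proof.
move=> wS; rewrite /op_phiz; case: ifP => _; last exact: lower_span_submodule.1.
apply: lower_span_k; apply: (opser_exp_mem lower_span_submodule) => // j u uS.
case: eqP => [_|/eqP j0]; first exact: lower_span_submodule.1.
apply: (submodZ lower_span_submodule); apply: lower_span_h => //.
by case: e; rewrite /= ?mul1r ?mulN1r ?oppr_eq0.
Qed.

Lemma lower_span_xp i r w : lower_span w -> lower_span (op_x g true i r w).
Proof.
apply: lower_span_linear => u; elim=> [|j s x xw IHx].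
  by rewrite v_x; apply: lower_span_submodule.1.
have /(canRL (subrK _)) -> := qaff_pm rel i r j s x.
apply: (submodD lower_span_submodule); last exact: lower_span_xm.
have xS := lower_span_word xw.
case: eqP => _; last exact: lower_span_submodule.1.
apply: (submodZ lower_span_submodule).
by apply: (submodB lower_span_submodule); apply: lower_span_phiz.
Qed.

(** The span of the words in the x^- contains v and is stable under all generators,
by the commutation relations: V is generated by v under the x^- alone. *)
Lemma lower_spanT w : lower_span w.
Proof.
elim: (v_cyclic w) => [|c x y _ xS _ yS|[] i r x _ xS|h x _ xS|i m x m0 _ xS].
- exact: (lower_span_word lower_word0).
- exact: lower_span_submodule.2.
- exact: lower_span_xp.
- exact: lower_span_xm.
- exact: lower_span_k.
- exact: lower_span_h.
Qed.

(** The step may assume w to be a weight vector since all the words in the x^- are;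
this is where the recurrence [x_recurrence] becomes available. *)
Lemma highest_weight_ind (S : V -> Prop) :
  is_submodule S -> S v ->
  (forall om i r w, weight_vector q g om w -> S w -> S (op_x g false i r w)) ->
  forall w, S w.
Proof.
move=> subS Sv Sx w; apply: (@lower_spanT w S) => // u.
elim=> // i r x xw Sx'; have [om xom] := lower_word_weight xw.
exact: Sx xom Sx'.
Qed.

End HighestWeight.
End Module.
End QuantumAffinization.

(** * The action of the lowering operators on the fusion product *)

Section Fusion.
Variables (n : nat) (C : cartan_datum n) (H : realization C).
Variables (K : closedFieldType) (q : quantum_parameter K).
Variables (V V' T : lmodType K) (tens : {bilinear V -> V' -> T}).
Variables (W : lmodType (ratfun K)) (ext : {linear T -> W | @ratfunC K \; *:%R}).
Variables (g : generator_action H V) (g' : generator_action H V').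
Variable gW : generator_action H W.
Hypotheses (rel : qaff_relations q g) (rel' : qaff_relations q g').
Hypotheses (gMod : in_Mod q g) (gMod' : in_Mod q g').
Hypothesis fus : is_fusion q g g' tens ext gW.
Variable S : W -> Prop.
Hypothesis subS : is_submodule S.
Hypothesis S_x : forall i r w, S w -> S (op_x gW false i r w).

(** Delta_u(x^-_{i,r}) is the sum of u^r (1 (x) x^-_{i,r}) and of a series; this
is the expansion of the contribution of the latter. *)
Lemma expands_residual i r w w' :
  expands_to ext
    (op_x gW false i r (ext (tens w w'))
      - ratfunX K ^ r *: ext (tens w (op_x g' false i r w')))
    (fun m => tens (op_x g false i (r - m) w) (op_phiz q g' true i m w')).
Proof.
have := expandsD (fusion_xm fus i r w w')
  (expandsZ (-1) r (expands_ext ext (tens w (op_x g' false i r w')))).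
rewrite rmorphN1 mulN1r scaleNr; apply: eq_expands => m.
rewrite subr_eq0 scaleN1r; case: eqP => _; last by rewrite add0r subr0.
by rewrite addrAC subrr add0r.
Qed.

(** As functions of r, the contribution of the series satisfies the recurrence of
x^-_{i,r} w, with constant coefficients, and a_r = u^r (w (x) x^-_{i,r} w')
that of x^-_{i,r} w' dilated by u.  The two recurrences are coprime. *)
Lemma lower_right_mem om om' i r w w' :
  weight_vector q g om w -> weight_vector q g' om' w' -> S (ext (tens w w')) ->
  S (ext (tens w (op_x g' false i r w'))).
Proof.
move=> ww ww' Sww.
have [P P0 Pw] := x_recurrence rel om i gMod.
have [P' P'0 Pw'] := x_recurrence rel' om' i gMod'.
pose a s : W := ratfunX K ^ s *: ext (tens w (op_x g' false i s w')).
pose y s := op_x gW false i s (ext (tens w w')).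
suff Sa s : S (a s).
  have := submodZ subS (ratfunX K ^ (- r)) (Sa r).
  by rewrite scalerA -expfzDr ?ratfunX_neq0 // addNr scale1r.
have P_neq0 : P != 0 by apply: contraNneq P0 => ->; rewrite coef0.
apply: (coprime_conv_mem subS (coprimep_dilate P_neq0 P'0)) => {}s.
  have -> : conv (map_poly (@ratfunC K) P) a s = conv (map_poly (@ratfunC K) P) y s.
    apply/esym/eqP; rewrite -subr_eq0 -sumrB; apply/eqP.
    under eq_bigr => k _ do rewrite -scalerBr.
    apply: expands_eq0 (expands_conv P (fun s => expands_residual i s w w') s) _ => m.
    transitivity (tens (conv P (fun s => op_x g false i s w) (s - m))
        (op_phiz q g' true i m w')).
      rewrite linear_sumlz; apply: eq_bigr => k _.
      by rewrite linearZl_LR addrAC.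
    by rewrite Pw // linear0l.
  by apply: conv_mem => // t; apply: S_x.
have -> : conv (dilate P') a s = 0; last exact: subS.1.
pose a' s m := if m == s then tens w (op_x g' false i s w') else 0.
have aa' t : expands_to ext (a t) (a' t).
  have := expandsZ 1 t (expands_ext ext (tens w (op_x g' false i t w'))).
  rewrite rmorph1 mul1r; apply: eq_expands => m.
  by rewrite subr_eq0 scale1r.
apply: expands_eq0 (expands_conv_dilate P' aa' s) _ => m.
have [->|ms] := eqVneq m s.
  transitivity (tens w (conv P' (fun s => op_x g' false i s w') s)); last first.
    by rewrite Pw' // linear0r.
  rewrite linear_sumr; apply: eq_bigr => k _.
  by rewrite linearZr_LR /a' eqxx.
rewrite big1 // => k _; rewrite /a' (_ : (_ == _) = false) ?scaler0 //.
by apply/eqP => /addIr /eqP; apply/negP.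
Qed.

Section HighestRight.
Variables (v' : V') (la' : weight H) (Psi' : bool -> 'I_n -> nat -> K).
Hypothesis v'_weight : weight_vector q g' la' v'.
Hypothesis v'_x : forall i r, op_x g' true i r v' = 0.
Hypothesis v'_phi : forall e i m, op_phi q g' e i m v' = Psi' e i m *: v'.
Hypothesis Psi'_compat : compatible_weight q la' Psi'.
Hypothesis v'_neq0 : v' != 0.

(* The series Psi'^+_i(z), extended by 0 to negative indices. *)
Let series i (m : int) : K^o := if 0 <= m then Psi' true i `|m|%N else 0.

Let series_lt0 i m : m < 0 -> series i m = 0.
Proof. by move=> m0; rewrite /series ifN // -ltNge. Qed.

Lemma phiz_highest i m : op_phiz q g' true i m v' = series i m *: v'.
Proof. by rewrite /op_phiz /series mul1r; case: ifP; rewrite ?scale0r. Qed.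

(** The series Psi'^+_i is rational, with denominator a recurrence p of the
x^-_{i,r} v': by [qaff_pm], applying x^+_{i,0} to x^-_{i,m} v' yields
a multiple of (phi^+_{i,m} - phi^-_{i,m}) v', where phi^-_{i,m} = 0 if m > 0.
Hence p kills the coefficients of Psi'^+_i of index at least size p. *)
Lemma rational_series i (p : {poly K}) :
  p`_0 != 0 -> (forall r, conv p (fun s => op_x g' false i s v') r = 0) ->
  exists2 N : {poly K}, N`_0 != 0 & conv p (series i) =1 coefz N.
Proof.
move=> p0 px; pose N := \poly_(k < size p) (conv p (series i) k%:Z : K).
have size_p : (0 < size p)%N.
  by rewrite ltnNge; apply: contra p0 => p_size; rewrite nth_default.
exists N.
  rewrite coef_poly size_p /conv -(prednK size_p) big_ord_recl big1 => [|k _].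
    rewrite addr0 subr0 /series /= mulf_neq0 //.
    by rewrite Psi'_compat qpow_neq0.
  by rewrite series_lt0 ?scaler0 // sub0r oppr_lt0.
move=> m; rewrite /coefz coef_poly; case: (lerP 0 m) => [m0|m0]; last first.
  rewrite /conv big1 // => k _; rewrite series_lt0 ?scaler0 //.
  by rewrite (le_lt_trans _ m0) // gerBl.
case: ltnP => mp; first by rewrite gez0_abs.
have c0 := qpow_sub_inv_neq0 q (symm_gt0 C i).
have series_x k : (k < size p)%N -> series i (m - k%:Z) *: v' =
    (q (symm C i)%:R - (q (symm C i)%:R)^-1) *:
       op_x g' true i 0 (op_x g' false i (m - k%:Z) v').
  move=> kp; have := qaff_pm rel' i 0 i (m - k%:Z) v'.
  rewrite eqxx v'_x linear0 subr0 add0r => ->; rewrite scalerA mulfV // scale1r.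
  rewrite phiz_highest /op_phiz /= ifN ?subr0 // mulN1r -ltNge.
  by rewrite oppr_lt0 subr_gt0; lia.
apply/eqP; have : conv p (series i) m *: v' == 0; last first.
  by rewrite scaler_eq0 (negPf v'_neq0) orbF.
rewrite /conv scaler_suml; apply/eqP.
transitivity ((q (symm C i)%:R - (q (symm C i)%:R)^-1) *:
       op_x g' true i 0 (conv p (fun s => op_x g' false i s v') m)).
  rewrite conv_linear scaler_sumr; apply: eq_bigr => k _.
  by rewrite -scalerA series_x // !scalerA mulrC.
by rewrite px linear0 scaler0.
Qed.

(** By [lower_right_mem], S contains the series part B_r of the action of x^-_{i,r},
which is the sum over m of u^m Psi'^+_{i,m} A_{r-m}, for A_r = x^-_{i,r} w (x) v'.
Multiplying by the denominator P'(uz) of Psi'^+_i(uz) gives N(uz) A, which thus lies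
in S, while P(z) A = 0; as N_0 != 0, these two polynomials are coprime. *)
Lemma lower_left_mem om i r w :
  weight_vector q g om w -> S (ext (tens w v')) ->
  S (ext (tens (op_x g false i r w) v')).
Proof.
move=> ww Swv.
have [P P0 Pw] := x_recurrence rel om i gMod.
have [P' P'0 Pv'] := x_recurrence rel' la' i gMod'.
have [N N0 NE] := rational_series P'0 (Pv' _ v'_weight).
pose A s := ext (tens (op_x g false i s w) v').
pose B s := op_x gW false i s (ext (tens w v'))
      - ratfunX K ^ s *: ext (tens w (op_x g' false i s v')).
have SB s : S (B s).
  apply: submodB => //; first exact: S_x.
  by apply: submodZ => //; apply: (lower_right_mem i s ww v'_weight).
suff SA s : S (A s) by apply: SA.
have P_neq0 : P != 0 by apply: contraNneq P0 => ->; rewrite coef0.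
apply: (coprime_conv_mem subS (coprimep_dilate P_neq0 N0)) => {}s.
  have -> : conv (map_poly (@ratfunC K) P) A s = 0; last exact: subS.1.
  transitivity (ext (tens (conv P (fun s => op_x g false i s w) s) v')); last first.
    by rewrite Pw // linear0l linear0.
  rewrite linear_sumlz linear_sum /conv size_map_poly; apply: eq_bigr => k _.
  by rewrite coef_map linearZl_LR linearZ.
have -> : conv (dilate N) A s = conv (dilate P') B s; last exact: conv_mem.
have EB := expands_conv_dilate P' (fun s => expands_residual i s w v') s.
have EA := expands_conv_dilate N
  (fun s => expands_ext ext (tens (op_x g false i s w) v')) s.
apply: expands_inj EA _; apply: eq_expands EB => m.
(* On the left the coefficient of u^m is that of the series P' Psi'. *)
transitivity (coefz N m *: tens (op_x g false i (s - m) w) v').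
  rewrite -NE /conv scaler_suml; apply: eq_bigr => k _.
  by rewrite phiz_highest linearZr_LR scalerA opprB addrA subrK.
rewrite -[N in LHS]mulr1 -conv_coefz /conv scaler_suml; apply: eq_bigr => k _.
rewrite -scalerA; congr (_ *: _).
case: eqVneq => [/eqP|mk].
  by rewrite subr_eq0 => /eqP ->; rewrite subrr /coefz coef1 scale1r.
rewrite [coefz _ _](_ : _ = 0) ?scale0r // /coefz coef1; case: ifP => // _.
by rewrite absz_eq0 (negPf mk).
Qed.

End HighestRight.

End Fusion.

(** * Laurent polynomials *)

Section LaurentPolynomial.
Variable K : fieldType.

Lemma laurent_polynomial_monomial (c : K) (z : int) :
  is_laurent_polynomial (ratfunX K ^ z * ratfunC c).
Proof.
case: z => m; [exists (c *: 'X^m), 0%N | exists c%:P, m.+1].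
  by rewrite expr0 divr1 -mul_polyC rmorphM rmorphXn mulrC.
by rewrite mulrC.
Qed.

Lemma laurent_polynomialD (f1 f2 : ratfun K) :
  is_laurent_polynomial f1 -> is_laurent_polynomial f2 ->
  is_laurent_polynomial (f1 + f2).
Proof.
move=> [p1 [n1 ->]] [p2 [n2 ->]]; exists (p1 * 'X^n2 + p2 * 'X^n1), (n1 + n2)%N.
rewrite addf_div ?expf_neq0 ?ratfunX_neq0 // exprD.
by rewrite rmorphD !rmorphM !rmorphXn.
Qed.

End LaurentPolynomial.

(** * The fusion product is of highest weight *)

Lemma cyclic_submodule_is_submodule (n : nat) (C : cartan_datum n)
    (H : realization C) (K : fieldType) (V : lmodType K)
    (g : generator_action H V) (v : V) : is_submodule (cyclic_submodule g v).
Proof.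
split=> [|c x y]; last exact: cyclic_lin.
by rewrite -(addNr v) -scaleN1r; apply: cyclic_lin; apply: cyclic_gen.
Qed.

Section FusionHighestWeight.
Variables (n : nat) (C : cartan_datum n) (H : realization C).
Variables (K : closedFieldType) (q : quantum_parameter K).
Variables (V V' T : lmodType K) (tens : {bilinear V -> V' -> T}).
Variables (W : lmodType (ratfun K)) (ext : {linear T -> W | @ratfunC K \; *:%R}).
Variables (g : generator_action H V) (g' : generator_action H V').
Variable gW : generator_action H W.
Hypotheses (rel : qaff_relations q g) (rel' : qaff_relations q g').
Hypotheses (gMod : in_Mod q g) (gMod' : in_Mod q g').
Hypothesis fus : is_fusion q g g' tens ext gW.
Hypotheses (tensP : is_tensor_product tens) (extP : is_scalar_extension ext).

(** First V (x) v', by induction on V; then w (x) V' for each weight vector w of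
V, by induction on V'. *)
Lemma fusion_lu_highest_weight :
  l_highest_weight q g -> l_highest_weight q g' -> lu_highest_weight q gW.
Proof.
move=> [la [Psi [_ Psi_compat [v [v_wt v_cyc v_x v_phi]]]]].
move=> [la' [Psi' [_ Psi'_compat [v' [v'_wt v'_cyc v'_x v'_phi]]]]].
exists (la + la'), (fun e i m => \sum_(s < m.+1)
  ratfunX K ^ (pm e * (s : nat)%:Z) * ratfunC (Psi e i (m - s)%N * Psi' e i s)).
split.
- move=> e i m; elim/big_ind: _ => [||s _].
  + by exists 0, 0%N; rewrite rmorph0 mul0r.
  + exact: laurent_polynomialD.
  + exact: laurent_polynomial_monomial.
- move=> e i; rewrite big_ord1 mulr0 expr0z mul1r Psi_compat Psi'_compat /=.
  by rewrite -qpowD -!mulrDr add_lfunE.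
exists (ext (tens v v')); split.
- move=> h; rewrite (fusion_k fus) v_wt v'_wt /= linearZl_LR linearZr_LR scalerA.
  by rewrite -qpowD linearZ /= add_lfunE.
- pose S := cyclic_submodule gW (ext (tens v v')).
  have subS : is_submodule S by apply: cyclic_submodule_is_submodule.
  have S_x i r w : S w -> S (op_x gW false i r w) by apply: cyclic_x.
  have comap (X : lmodType K) (f : X -> T) : linear f ->
      is_submodule (fun x => S (ext (f x))).
    move=> f_lin; split=> [|c x y Sx Sy].
      have := f_lin (-1) 0 0; rewrite scaler0 addr0 scaleN1r addNr => ->.
      by rewrite linear0; apply: subS.1.
    by rewrite f_lin linearP; apply: subS.2.
  have S_left w : S (ext (tens w v')).
    have [v'0|v'0] := eqVneq v' 0; first by rewrite v'0 linear0r linear0; apply: subS.1.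
    apply: (highest_weight_ind rel v_wt v_cyc v_x v_phi
      (S := fun w => S (ext (tens w v')))).
    + by apply: comap => c x y; rewrite linearPl.
    + exact: cyclic_gen.
    + move=> om i r {}w ww.
      exact: (lower_left_mem rel rel' gMod gMod' fus subS S_x
        v'_wt v'_x v'_phi Psi'_compat v'0 i r ww).
  have S_weight om w : weight_vector q g om w -> forall w', S (ext (tens w w')).
    move=> ww; apply: (highest_weight_ind rel' v'_wt v'_cyc v'_x v'_phi) => //.
    + by apply: comap => c x y; rewrite linearPr.
    + move=> om' i r w'.
      exact: (lower_right_mem rel rel' gMod gMod' fus subS S_x i r ww).
  have S_tens w w' : S (ext (tens w w')).
    have [N [om [u [uw ->]]]] := Mod_span gMod w.
    rewrite linear_sumlz linear_sum; apply: submod_sum => // a _.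
    exact: S_weight (uw a) _.
  apply: (scalar_extension_span extP subS); apply: (tensor_span tensP) => //.
  exact: comap.
- move=> i r; apply: expands_eq0 (fusion_xp fus i r v v') _ => m.
  by rewrite v_x v'_x linear0l linear0r if_same addr0.
- move=> e i m; rewrite (fusion_phi fus) scaler_suml; apply: eq_bigr => s _.
  by rewrite v_phi v'_phi linearZl_LR linearZr_LR scalerA linearZ /= scalerA.
Qed.

End FusionHighestWeight.

Theorem theorem6p2 (R : realType) (n : nat) (C : cartan_datum n)
    (H : realization C) (q : quantum_parameter R[i])
    (V V' : lmodType R[i])
    (mV : qaff_module H q V) (mV' : qaff_module H q V')
    (VMod : in_Mod q mV) (VMod' : in_Mod q mV')
    (Vhw : l_highest_weight q mV) (Vhw' : l_highest_weight q mV')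
    (T : lmodType R[i]) (tens : {bilinear V -> V' -> T})
    (Ttens : is_tensor_product tens)
    (W : lmodType (ratfun R[i]))
    (ext : {linear T -> W | @ratfunC R[i] \; *:%R})
    (Wext : is_scalar_extension ext)
    (mW : qaff_module H (@ratfunC R[i] \o q) W)
    (Wfusion : is_fusion q mV mV' tens ext mW) :
  lu_highest_weight q mW.
Proof.
case: mV VMod Vhw Wfusion => g rel gMod Vhw.
case: mV' VMod' Vhw' => g' rel' gMod' Vhw' Wfusion.
exact: (fusion_lu_highest_weight rel rel' gMod gMod' Wfusion Ttens Wext Vhw Vhw').
Qed.
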